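(* Let $\mathbb{k}$ be a field containing $\mathbb{Q}$ and let $\mathcal{T}=(A,B,\varepsilon)$ be a commutative triple over $\mathbb{k}$. Then the map $$d:B\otimes A\longrightarrow\Omega^1_{\mathcal{T}|\mathbb{k}},\qquad \alpha\otimes a\longmapsto d(\alpha\otimes a),$$ is the universal secondary derivation. That is, $d$ is a secondary derivation of $\mathcal{T}$ with values in $\Omega^1_{\mathcal{T}|\mathbb{k}}$, and for every secondary derivation $\delta:B\otimes A\to N$ of $\mathcal{T}$ there exists a unique $A$-linear map $\varphi:\Omega^1_{\mathcal{T}|\mathbb{k}}\to N$ such that $\delta=\varphi\circ d$.
   Context: Conventions: $\mathbb{k}$ is a field containing $\mathbb{Q}$, $\otimes=\otimes_{\mathbb{k}}$, and all $\mathbb{k}$-algebras are associative with unit. Commutative triple: $(A,B,\varepsilon)$ where $A$ and $B$ are commutative $\mathbb{k}$-algebras and $\varepsilon:B\to A$ is a morphism of $\mathbb{k}$-algebras. Secondary derivations: let $\mathcal{T}=(A,B,\varepsilon)$ be a commutative triple and $M$ a symmetric $A$-bimodule (equivalently an $A$-module), regarded as a symmetric $B\otimes A$-bimodule via $(\alpha\otimes a)\cdot m=a\varepsilon(\alpha)m=m\,a\varepsilon(\alpha)=m\cdot(\alpha\otimes a)$. A secondary derivation of $\mathcal{T}$ with values in $M$ is a $\mathbb{k}$-linear map $D:B\otimes A\to M$ such that for all $a,b\in A$, $\alpha,\beta\in B$: (1) $D((\alpha\otimes a)(\beta\otimes b))=a\varepsilon(\alpha)D(\beta\otimes b)+D(\alpha\otimes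 a)b\varepsilon(\beta)$, where $(\alpha\otimes a)(\beta\otimes b)=\alpha\beta\otimes ab$; and (2) $D(\alpha\otimes 1)+D(\alpha\otimes 1)=D(1\otimes\varepsilon(\alpha))$. Secondary Kähler differentials: $\Omega^1_{\mathcal{T}|\mathbb{k}}$ is the left $B\otimes A$-module generated by the $\mathbb{k}$-linear symbols $d(\alpha\otimes a)$ for $\alpha\in B$, $a\in A$ (so $d(x)$ is defined for every $x\in B\otimes A$, $\mathbb{k}$-linearly in $x$), where $B\otimes A$ acts through $A$ by $(\alpha\otimes a)\cdot d(\beta\otimes b)=a\varepsilon(\alpha)\,d(\beta\otimes b)$, i.e. it is the $A$-module on these generators, subject to the relations, for all $a,b\in A$, $\alpha,\beta\in B$, $\lambda,\mu\in\mathbb{k}$: (i) $d(\lambda(\alpha\otimes a)+\mu(\beta\otimes b))=\lambda d(\alpha\otimes a)+\mu d(\beta\otimes b)$; (ii) $d((\alpha\otimes a)(\beta\otimes b))=a\varepsilon(\alpha)d(\beta\otimes b)+b\varepsilon(\beta)d(\alpha\otimes a)$; (iii) $d(\alpha\otimes 1)+d(\alpha\otimes 1)=d(1\otimes\varepsilon(\alpha))$. *)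

(* Defs.v *)
From HB Require Import structures.
From mathcomp Require Import all_boot all_order all_algebra.
From mathcomp Require Import generic_quotient boolp functions.

Set Implicit Arguments.
Unset Strict Implicit.
Unset Printing Implicit Defensive.

Import GRing.Theory.
Local Open Scope ring_scope.
Local Open Scope quotient_scope.

(** [presmod rel] is the [R]-module generated by the symbols [pgen rel x],
    [x : X], subject to the relations [rel]: formal [R]-linear expressions
    modulo the least congruence containing [rel] and the module axioms.
    The library's free modules ([{freeg X / R}]) require [1 != 0] in [R]. *)

Inductive mterm (R X : Type) : Type :=
| MGen of X
| MZero
| MOpp of mterm R X
| MAdd of mterm R X & mterm R X
| MScale of R & mterm R X.

Arguments MZero {R X}.
Arguments MGen {R X} _.

HB.instance Definition _ R X := gen_eqMixin (mterm R X).
HB.instance Definition _ R X := gen_choiceMixin (mterm R X).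

Section Presentation.
Variables (R : pzRingType) (X : Type) (rel : mterm R X -> mterm R X -> Prop).
Implicit Types (s t u : mterm R X) (a b : R).

Inductive mcong : mterm R X -> mterm R X -> Prop :=
| mcong_rel s t : rel s t -> mcong s t
| mcong_refl s : mcong s s
| mcong_sym s t : mcong s t -> mcong t s
| mcong_trans s t u : mcong s t -> mcong t u -> mcong s u
| mcong_opp s t : mcong s t -> mcong (MOpp s) (MOpp t)
| mcong_add s s' t t' :
    mcong s s' -> mcong t t' -> mcong (MAdd s t) (MAdd s' t')
| mcong_scale a s t : mcong s t -> mcong (MScale a s) (MScale a t)
| mcong_addA s t u : mcong (MAdd s (MAdd t u)) (MAdd (MAdd s t) u)
| mcong_addC s t : mcong (MAdd s t) (MAdd t s)
| mcong_add0 s : mcong (MAdd MZero s) s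
| mcong_addN s : mcong (MAdd (MOpp s) s) MZero
| mcong_scaleA a b s : mcong (MScale a (MScale b s)) (MScale (a * b) s)
| mcong_scale1 s : mcong (MScale 1 s) s
| mcong_scaleDr a s t :
    mcong (MScale a (MAdd s t)) (MAdd (MScale a s) (MScale a t))
| mcong_scaleDl a b s :
    mcong (MScale (a + b) s) (MAdd (MScale a s) (MScale b s)).

Definition mcongb s t : bool := `[< mcong s t >].

Lemma mcongb_equiv : equiv_class_of mcongb.
Proof.
split=> [s | s t | t s u].
- exact/asboolP/mcong_refl.
- by apply/asboolP/asboolP; apply: mcong_sym.
- by move=> /asboolP st /asboolP tu; apply/asboolP; apply: mcong_trans tu.
Qed.

Canonical mcong_equiv := EquivRelPack mcongb_equiv.
Canonical mcong_encModRel := defaultEncModRel mcongb.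

Definition presmod := {eq_quot mcongb}.
HB.instance Definition _ := Choice.on presmod.
HB.instance Definition _ := EqQuotient.on presmod.

Local Notation cl s := (\pi_presmod s).

Lemma presmod_eqP s t : reflect (cl s = cl t) `[< mcong s t >].
Proof. exact: eqmodP. Qed.

Lemma presmod_eq s t : mcong s t -> cl s = cl t.
Proof. by move=> st; apply/presmod_eqP/asboolP. Qed.

Lemma presmod_inv s t : cl s = cl t -> mcong s t.
Proof. by move=> /presmod_eqP/asboolP. Qed.

Lemma presmod_repr s : mcong (repr (cl s)) s.
Proof. by apply: presmod_inv; rewrite reprK. Qed.

Definition presmod_zero : presmod := cl MZero.
Definition presmod_opp (x : presmod) : presmod := cl (MOpp (repr x)).
Definition presmod_add (x y : presmod) : presmod := cl (MAdd (repr x) (repr y)).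
Definition presmod_scale a (x : presmod) : presmod := cl (MScale a (repr x)).

Lemma presmod_oppE s : presmod_opp (cl s) = cl (MOpp s).
Proof. exact/presmod_eq/mcong_opp/presmod_repr. Qed.

Lemma presmod_addE s t : presmod_add (cl s) (cl t) = cl (MAdd s t).
Proof. by apply/presmod_eq/mcong_add; apply: presmod_repr. Qed.

Lemma presmod_scaleE a s : presmod_scale a (cl s) = cl (MScale a s).
Proof. exact/presmod_eq/mcong_scale/presmod_repr. Qed.

Fact presmod_addA : associative presmod_add.
Proof.
elim/quotW=> s; elim/quotW=> t; elim/quotW=> u.
rewrite (presmod_addE t u) (presmod_addE s t) !presmod_addE.
by apply: presmod_eq; apply: mcong_addA.
Qed.

Fact presmod_addC : commutative presmod_add.
Proof.
elim/quotW=> s; elim/quotW=> t.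
by rewrite !presmod_addE; apply: presmod_eq; apply: mcong_addC.
Qed.

Fact presmod_add0 : left_id presmod_zero presmod_add.
Proof.
by elim/quotW=> s; rewrite presmod_addE; apply: presmod_eq; apply: mcong_add0.
Qed.

Fact presmod_addN : left_inverse presmod_zero presmod_opp presmod_add.
Proof.
elim/quotW=> s; rewrite presmod_oppE presmod_addE.
by apply: presmod_eq; apply: mcong_addN.
Qed.

HB.instance Definition _ := GRing.isZmodule.Build presmod
  presmod_addA presmod_addC presmod_add0 presmod_addN.

Lemma presmodD s t : cl s + cl t = cl (MAdd s t) :> presmod.
Proof. exact: presmod_addE. Qed.

Fact presmod_scaleA a b (x : presmod) :
  presmod_scale a (presmod_scale b x) = presmod_scale (a * b) x.
Proof.
elim/quotW: x => s; rewrite (presmod_scaleE b s) !presmod_scaleE.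
by apply: presmod_eq; apply: mcong_scaleA.
Qed.

Fact presmod_scale1 : left_id 1 presmod_scale.
Proof.
by elim/quotW=> s; rewrite presmod_scaleE; apply: presmod_eq; apply: mcong_scale1.
Qed.

Fact presmod_scaleDr : right_distributive presmod_scale +%R.
Proof.
move=> a; elim/quotW=> s; elim/quotW=> t.
rewrite presmodD !presmod_scaleE presmodD.
by apply: presmod_eq; apply: mcong_scaleDr.
Qed.

Fact presmod_scaleDl (x : presmod) :
  {morph presmod_scale^~ x : a b / a + b}.
Proof.
move=> a b; elim/quotW: x => s.
rewrite !presmod_scaleE presmodD.
by apply: presmod_eq; apply: mcong_scaleDl.
Qed.

HB.instance Definition _ := GRing.Zmodule_isLmodule.Build R presmod
  presmod_scaleA presmod_scale1 presmod_scaleDr presmod_scaleDl.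

Definition pgen (x : X) : presmod := cl (MGen x).

Fixpoint meval (M : lmodType R) (f : X -> M) (s : mterm R X) : M :=
  match s with
  | MGen x => f x
  | MZero => 0
  | MOpp s => - meval f s
  | MAdd s t => meval f s + meval f t
  | MScale a s => a *: meval f s
  end.

Lemma meval_pgen s : meval pgen s = cl s.
Proof.
elim: s => //= [s -> | s -> t -> | a s ->].
- exact: presmod_oppE.
- exact: presmod_addE.
- exact: presmod_scaleE.
Qed.

Lemma pgen_rel s t : rel s t -> meval pgen s = meval pgen t.
Proof. by move=> st; rewrite !meval_pgen; apply: presmod_eq; apply: mcong_rel. Qed.

Lemma presmod_ind (P : presmod -> Prop) :
  (forall x, P (pgen x)) -> P 0 -> (forall x, P x -> P (- x)) ->
  (forall x y, P x -> P y -> P (x + y)) -> (forall a x, P x -> P (a *: x)) ->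
  forall x, P x.
Proof.
move=> Pg P0 PN PD PZ; elim/quotW=> s; rewrite -meval_pgen.
by elim: s => //= [s /PN | s Ps t /(PD _ _ Ps) | a s /(PZ a)].
Qed.

Section Lift.
Variables (M : lmodType R) (f : X -> M).

Definition presmod_lift (x : presmod) : M := meval f (repr x).

Hypothesis frel : forall s t, rel s t -> meval f s = meval f t.

Lemma meval_mcong s t : mcong s t -> meval f s = meval f t.
Proof.
elim=> {s t} //=.
- by move=> s t u _ -> _ ->.
- by move=> s t _ ->.
- by move=> s s' t t' _ -> _ ->.
- by move=> a s t _ ->.
- by move=> s t u; rewrite addrA.
- by move=> s t; rewrite addrC.
- by move=> s; rewrite add0r.
- by move=> s; rewrite addNr.
- by move=> a b s; rewrite scalerA.
- by move=> s; rewrite scale1r.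
- by move=> a s t; rewrite scalerDr.
- by move=> a b s; rewrite scalerDl.
Qed.

Lemma presmod_liftE s : presmod_lift (cl s) = meval f s.
Proof. exact/meval_mcong/presmod_repr. Qed.

Lemma presmod_lift_gen x : presmod_lift (pgen x) = f x.
Proof. exact: presmod_liftE. Qed.

Lemma presmod_lift_linear : linear presmod_lift.
Proof.
move=> a; elim/quotW=> s; elim/quotW=> t.
by rewrite [_ *: _]presmod_scaleE presmodD !presmod_liftE.
Qed.

End Lift.

End Presentation.

(** The library's [comAlgType] excludes the zero algebra; [comPzAlgType] does
    not. The algebra structure is given by the structure morphism [alg_in]. *)
HB.mixin Record isComPzAlg (k : pzRingType) A of GRing.ComPzRing A := {
  alg_in : k -> A;
  alg_in_zmod_morphism : zmod_morphism alg_in;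
  alg_in_monoid_morphism : monoid_morphism alg_in
}.

#[short(type="comPzAlgType")]
HB.structure Definition ComPzAlg (k : pzRingType) :=
  {A of GRing.ComPzRing A & isComPzAlg k A}.

Arguments alg_in {k} s _ : rename.

HB.instance Definition _ (k : pzRingType) (A : comPzAlgType k) :=
  GRing.isZmodMorphism.Build k A (alg_in A) alg_in_zmod_morphism.
HB.instance Definition _ (k : pzRingType) (A : comPzAlgType k) :=
  GRing.isMonoidMorphism.Build k A (alg_in A) alg_in_monoid_morphism.

HB.instance Definition _ (k : pzRingType) (A : comAlgType k) :=
  isComPzAlg.Build k A (rmorphB (in_alg A))
    (conj (rmorph1 (in_alg A)) (rmorphM (in_alg A))).

Section Tensor.
Variables (k : fieldType) (B A : comPzAlgType k).

Inductive tensor_rel :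
  mterm k (B * A)%type -> mterm k (B * A)%type -> Prop :=
| tensor_relDl (x y : B) (a : A) :
    tensor_rel (MGen (x + y, a)) (MAdd (MGen (x, a)) (MGen (y, a)))
| tensor_relDr (x : B) (a b : A) :
    tensor_rel (MGen (x, a + b)) (MAdd (MGen (x, a)) (MGen (x, b)))
| tensor_relZl (c : k) (x : B) (a : A) :
    tensor_rel (MGen (alg_in B c * x, a)) (MScale c (MGen (x, a)))
| tensor_relZr (c : k) (x : B) (a : A) :
    tensor_rel (MGen (x, alg_in A c * a)) (MScale c (MGen (x, a))).

Definition tensor := presmod tensor_rel.
HB.instance Definition _ := GRing.Lmodule.on tensor.

Definition tens (x : B) (a : A) : tensor := pgen tensor_rel (x, a).

Lemma tensDl x y a : tens (x + y) a = tens x a + tens y a.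
Proof. exact: (pgen_rel (tensor_relDl x y a)). Qed.

Lemma tensDr x a b : tens x (a + b) = tens x a + tens x b.
Proof. exact: (pgen_rel (tensor_relDr x a b)). Qed.

Lemma tensZl c x a : tens (alg_in B c * x) a = c *: tens x a.
Proof. exact: (pgen_rel (tensor_relZl c x a)). Qed.

Lemma tensZr c x a : tens x (alg_in A c * a) = c *: tens x a.
Proof. exact: (pgen_rel (tensor_relZr c x a)). Qed.

Lemma tensor_ind (P : tensor -> Prop) :
  (forall x a, P (tens x a)) -> (forall c u v, P u -> P v -> P (c *: u + v)) ->
  forall u, P u.
Proof.
move=> Pt Plin.
have P0 : P 0 by rewrite -(addNr (tens 0 0)) -scaleN1r; apply: Plin; apply: Pt.
have PZ c u : P u -> P (c *: u).
  by move=> Pu; rewrite -[_ *: u]addr0; apply: Plin.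
apply: presmod_ind => //.
- by case=> x a; apply: Pt.
- by move=> u /(PZ (-1)); rewrite scaleN1r.
- by move=> u v Pu Pv; rewrite -[u]scale1r; apply: Plin.
Qed.

Section TensorLift.
Variables (M : lmodType k) (f : B -> A -> M).
Hypothesis fDl : forall x y a, f (x + y) a = f x a + f y a.
Hypothesis fDr : forall x a b, f x (a + b) = f x a + f x b.
Hypothesis fZl : forall c x a, f (alg_in B c * x) a = c *: f x a.
Hypothesis fZr : forall c x a, f x (alg_in A c * a) = c *: f x a.

Definition tensor_lift (u : tensor) : M := presmod_lift (fun p => f p.1 p.2) u.

Lemma tensor_lift_rel s t : tensor_rel s t ->
  meval (fun p => f p.1 p.2) s = meval (fun p => f p.1 p.2) t.
Proof.
by case=> *; rewrite /= ?fDl ?fDr ?fZl ?fZr.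
Qed.

Lemma tensor_liftE x a : tensor_lift (tens x a) = f x a.
Proof. exact: (presmod_lift_gen tensor_lift_rel). Qed.

Lemma tensor_lift_linear : linear tensor_lift.
Proof. exact: (presmod_lift_linear tensor_lift_rel). Qed.

End TensorLift.

(** Left multiplication by [x ⊗ a]; see [tensM] for the resulting product. *)
Definition tensor_mul_gen (x : B) (a : A) : tensor -> tensor :=
  tensor_lift (fun y b => tens (x * y) (a * b)).

Lemma tensor_mul_genE x a y b :
  tensor_mul_gen x a (tens y b) = tens (x * y) (a * b).
Proof.
apply: tensor_liftE => [y1 y2 b1 | y1 b1 b2 | c y1 b1 | c y1 b1].
- by rewrite mulrDr tensDl.
- by rewrite mulrDr tensDr.
- by rewrite mulrCA tensZl.
- by rewrite mulrCA tensZr.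
Qed.

Lemma tensor_mul_gen_linear x a : linear (tensor_mul_gen x a).
Proof.
apply: tensor_lift_linear => [y1 y2 b1 | y1 b1 b2 | c y1 b1 | c y1 b1].
- by rewrite mulrDr tensDl.
- by rewrite mulrDr tensDr.
- by rewrite mulrCA tensZl.
- by rewrite mulrCA tensZr.
Qed.

Definition tensor_mul : tensor -> tensor -> tensor :=
  tensor_lift (M := (tensor -> tensor)) tensor_mul_gen.

Lemma tensor_mul_gen_bilin :
  [/\ forall x y a, tensor_mul_gen (x + y) a
        = tensor_mul_gen x a + tensor_mul_gen y a,
      forall x a b, tensor_mul_gen x (a + b)
        = tensor_mul_gen x a + tensor_mul_gen x b,
      forall c x a, tensor_mul_gen (alg_in B c * x) a
        = c *: tensor_mul_gen x a
    & forall c x a, tensor_mul_gen x (alg_in A c * a)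
        = c *: tensor_mul_gen x a].
Proof.
split=> [x y a | x a b | c x a | c x a]; apply/funext; elim/tensor_ind.
- by move=> z d; rewrite addrfctE !tensor_mul_genE mulrDl tensDl.
- move=> c u v; rewrite !addrfctE !tensor_mul_gen_linear => -> ->.
  by rewrite scalerDr addrACA.
- by move=> z d; rewrite addrfctE !tensor_mul_genE mulrDl tensDr.
- move=> c u v; rewrite !addrfctE !tensor_mul_gen_linear => -> ->.
  by rewrite scalerDr addrACA.
- by move=> z d; rewrite scalrfctE !tensor_mul_genE -mulrA tensZl.
- move=> e u v; rewrite !scalrfctE !tensor_mul_gen_linear => -> ->.
  by rewrite scalerDr !scalerA mulrC.
- by move=> z d; rewrite scalrfctE !tensor_mul_genE -mulrA tensZr.
- move=> e u v; rewrite !scalrfctE !tensor_mul_gen_linear => -> ->.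
  by rewrite scalerDr !scalerA mulrC.
Qed.

Lemma tensor_mulE x a y b :
  tensor_mul (tens x a) (tens y b) = tens (x * y) (a * b).
Proof.
have [? ? ? ?] := tensor_mul_gen_bilin.
by rewrite /tensor_mul tensor_liftE // tensor_mul_genE.
Qed.

Lemma tensor_mul_linearl v : linear (tensor_mul^~ v).
Proof.
have [? ? ? ?] := tensor_mul_gen_bilin => c u u'.
by rewrite /tensor_mul tensor_lift_linear.
Qed.

Lemma tensor_mul_linearr u : linear (tensor_mul u).
Proof.
have [? ? ? ?] := tensor_mul_gen_bilin => c v v'.
elim/tensor_ind: u => [x a | e u u' IHu IHu'].
  by rewrite /tensor_mul tensor_liftE // tensor_mul_gen_linear.
rewrite !(tensor_mul_linearl _ e u u') IHu IHu' !scalerDr !scalerA.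
by rewrite [e * c]mulrC addrACA.
Qed.

Fact tensor_mulA : associative tensor_mul.
Proof.
move=> u v w; elim/tensor_ind: u => [x a | c u u' IHu IHu']; last first.
  by rewrite !tensor_mul_linearl IHu IHu'.
elim/tensor_ind: v => [y b | c v v' IHv IHv']; last first.
  by rewrite !(tensor_mul_linearl, tensor_mul_linearr) IHv IHv'.
elim/tensor_ind: w => [z d | c w w' IHw IHw']; last first.
  by rewrite !tensor_mul_linearr IHw IHw'.
by rewrite !tensor_mulE !mulrA.
Qed.

Fact tensor_mulC : commutative tensor_mul.
Proof.
move=> u v; elim/tensor_ind: u => [x a | c u u' IHu IHu']; last first.
  by rewrite tensor_mul_linearl tensor_mul_linearr IHu IHu'.
elim/tensor_ind: v => [y b | c v v' IHv IHv']; last first.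
  by rewrite tensor_mul_linearl tensor_mul_linearr IHv IHv'.
by rewrite !tensor_mulE [x * y]mulrC [a * b]mulrC.
Qed.

Fact tensor_mul1 : left_id (tens 1 1) tensor_mul.
Proof.
elim/tensor_ind => [x a | c u v IHu IHv]; first by rewrite tensor_mulE !mul1r.
by rewrite tensor_mul_linearr IHu IHv.
Qed.

Fact tensor_mulDl : left_distributive tensor_mul +%R.
Proof.
by move=> u v w; have := tensor_mul_linearl w 1 u v; rewrite !scale1r.
Qed.

HB.instance Definition _ := GRing.Zmodule_isComPzRing.Build tensor
  tensor_mulA tensor_mulC tensor_mul1 tensor_mulDl.

Lemma tensM x a y b : tens x a * tens y b = tens (x * y) (a * b).
Proof. exact: tensor_mulE. Qed.

End Tensor.

Notation "B ⊗ A" := (tensor B A) (at level 40, left associativity) : type_scope.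
Notation "x ⊗ a" := (tens x a) (at level 40, left associativity) : ring_scope.

Record comTriple (k : fieldType) := ComTriple {
  ctA : comPzAlgType k;
  ctB : comPzAlgType k;
  cteps : {rmorphism ctB -> ctA};
  cteps_alg : forall c : k, cteps (alg_in ctB c) = alg_in ctA c
}.

Section SecondaryDerivation.
Variables (k : fieldType) (T : comTriple k).
Local Notation A := (ctA T).
Local Notation B := (ctB T).
Local Notation eps := (cteps T).

(** Symmetric bimodules over [A] are [A]-modules, with [k] acting through
    [alg_in A] and [B ⊗ A] through [α ⊗ a |-> a * eps α]. *)
Definition secondary_derivation (M : lmodType A) (D : (B ⊗ A)%type -> M) :
    Prop :=
  [/\ linear_for (alg_in A \; *:%R) D,
      forall (al be : B) (a b : A),
        D ((al ⊗ a) * (be ⊗ b))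
          = (a * eps al) *: D (be ⊗ b) + (b * eps be) *: D (al ⊗ a)
    & forall al : B, D (al ⊗ 1) + D (al ⊗ 1) = D (1 ⊗ eps al)].

(** The symbols are the [d x] for all [x] in [B ⊗ A], [k]-linear in [x]. *)
Inductive skaehler_rel :
  mterm A (B ⊗ A)%type -> mterm A (B ⊗ A)%type -> Prop :=
| skaehler_rel_lin (c e : k) (x y : (B ⊗ A)%type) :
    skaehler_rel (MGen (c *: x + e *: y))
      (MAdd (MScale (alg_in A c) (MGen x)) (MScale (alg_in A e) (MGen y)))
| skaehler_rel_mul (al be : B) (a b : A) :
    skaehler_rel (MGen ((al ⊗ a) * (be ⊗ b)))
      (MAdd (MScale (a * eps al) (MGen (be ⊗ b)))
            (MScale (b * eps be) (MGen (al ⊗ a))))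
| skaehler_rel_eps (al : B) :
    skaehler_rel (MAdd (MGen (al ⊗ 1)) (MGen (al ⊗ 1)))
      (MGen (1 ⊗ eps al)).

Definition skaehler := presmod skaehler_rel.
HB.instance Definition _ := GRing.Lmodule.on skaehler.

Definition skaehler_d (x : (B ⊗ A)%type) : skaehler := pgen skaehler_rel x.

End SecondaryDerivation.

Arguments skaehler {k} T.
Arguments skaehler_d {k} T x.

(* Main.v *)
Require Import Defs.
From HB Require Import structures.
From mathcomp Require Import all_boot all_order all_algebra.

Set Implicit Arguments.
Unset Strict Implicit.
Unset Printing Implicit Defensive.

Import GRing.Theory.
Local Open Scope ring_scope.

(** The relations presenting [skaehler T] are the axioms of a secondary derivation, imposed on the
    symbols [d x]. Hence [d] is one, and any secondary derivation, as a function on generators,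
    respects the relations and so extends linearly to the quotient. The extension is unique because
    the [d x] generate the module. *)

Lemma skaehler_d_derivation (k : fieldType) (T : comTriple k) :
  secondary_derivation (skaehler_d T).
Proof.
split=> [c x y | al be a b | al].
(* The two-scalar relation at [e = 1] is the one-scalar form used by [linear_for]. *)
- have := pgen_rel (skaehler_rel_lin c 1 x y).
  by rewrite /= rmorph1 !scale1r.
- exact: (pgen_rel (skaehler_rel_mul al be a b)).
- exact: (pgen_rel (skaehler_rel_eps al)).
Qed.

(** This is the compatibility needed for [delta] to descend to the quotient. Only the linearity
    relation needs work, since it carries a scalar on both summands. *)
Lemma secondary_derivation_rel (k : fieldType) (T : comTriple k)
    (N : lmodType (ctA T)) (delta : (ctB T ⊗ ctA T)%type -> N) :
  secondary_derivation delta ->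
  forall s t, skaehler_rel s t -> meval delta s = meval delta t.
Proof.
case=> dlin dmul deps s t.
have d0 : delta 0 = 0.
  have := dlin 1 0 0; rewrite scale1r addr0 /= rmorph1 scale1r => d0E.
  by apply: (addrI (delta 0)); rewrite addr0 -d0E.
have dZ c x : delta (c *: x) = alg_in (ctA T) c *: delta x.
  by rewrite -[c *: x]addr0 dlin d0 addr0.
by case=> [c e x y | al be a b | al] /=; rewrite ?dlin ?dZ.
Qed.

(** Agreement on generators propagates through the module operations, by induction on the
    presentation. *)
Lemma linear_skaehler_ext (k : fieldType) (T : comTriple k)
    (N : lmodType (ctA T)) (phi psi : {linear skaehler T -> N}) :
  (forall x, psi (skaehler_d T x) = phi (skaehler_d T x)) -> psi =1 phi.
Proof.
move=> eq_d; apply: presmod_ind => [//||x IH|x y IHx IHy|a x IH].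
- by rewrite !linear0.
- by rewrite !linearN IH.
- by rewrite !linearD IHx IHy.
- by rewrite !linearZ IH.
Qed.

Theorem proposition4p2 (k : fieldType) (hk : [pchar k] =i pred0)
    (T : comTriple k) :
  secondary_derivation (skaehler_d T) /\
  (forall (N : lmodType (ctA T)) (delta : (ctB T ⊗ ctA T)%type -> N),
     secondary_derivation delta ->
     exists phi : {linear skaehler T -> N},
       (forall x, delta x = phi (skaehler_d T x)) /\
       (forall psi : {linear skaehler T -> N},
          (forall x, delta x = psi (skaehler_d T x)) -> psi =1 phi)).
Proof.
split=> [|N delta /secondary_derivation_rel drel].
  exact: skaehler_d_derivation.
(* The lift evaluates [delta] on a chosen representative; [drel] makes the value independent of the
   choice, hence linear. *)
pose lift : skaehler T -> N := presmod_lift delta.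
pose lift_lin := GRing.isLinear.Build _ _ _ _ lift (presmod_lift_linear drel).
pose phi : {linear skaehler T -> N} := HB.pack lift lift_lin.
have phi_d x : delta x = phi (skaehler_d T x).
  by rewrite [RHS](presmod_lift_gen drel).
exists phi; split=> // psi psi_d.
by apply: linear_skaehler_ext => x; rewrite -psi_d -phi_d.
Qed.
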